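(* For any integer $n \geq 0$ (with $a$ denoting a nonnegative integer), $$v_2(B_n(4,3)) = \begin{cases} 1 + 2 v_2(a), & \text{if } n=5a \text{ and } v_2(a) \leq 2, \\ 1 + v_2 \big( a(a+1) \big), & \text{if } n = 5a+1 \text{ and } v_2 \big( a(a+1) \big) \leq 5, \\ 3, & \text{if } n=5a + 2 \text{ and } v_2(a-1) \geq 2, \\ 0, & \text{if } n \equiv 3 \pmod{5}, \\ 0, & \text{if } n \equiv 4 \pmod{5}. \end{cases}$$ (No assertion is made for values of $n$ not covered by these cases.)
   Context: The sequence $\{B_n(4,3)\}_{n\geq 0}$ is defined by $B_n = B_{n-1}+B_{n-2}+B_{n-3}+B_{n-4}$ for $n \geq 4$, with $(B_0,B_1,B_2,B_3)=(0,0,0,1)$. $v_2$ denotes the 2-adic order (2-adic valuation), with the convention $v_2(0)=+\infty$. *)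

(* Defs.v *)
From mathcomp Require Import all_boot all_order all_algebra.
From mathcomp Require Import constructive_ereal.

Set Implicit Arguments.
Unset Strict Implicit.
Unset Printing Implicit Defensive.

Import Order.TTheory GRing.Theory Num.Theory.

Fixpoint B43 (n : nat) : nat :=
  match n with
  | 0 | 1 | 2 => 0
  | 3 => 1
  | (((m.+1 as m1).+1 as m2).+1 as m3).+1 => B43 m3 + B43 m2 + B43 m1 + B43 m
  end.

(* [logn 2 0 = 0], hence the separate case giving v2(0) = +oo. *)
Definition v2 (x : int) : \bar int :=
  if x == 0%R then +oo%E else ((logn 2 `|x|%N)%:Z)%:E%E.

(* Main.v *)
(** Modulo [2 ^ 7] the sequence is periodic with period [320 = 5 * 2 ^ 6], and
    every valuation asserted by the theorem is at most [6].  Both sides therefore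
    only depend on [n] modulo [320], that is on [a] modulo [64], and the theorem
    reduces to a finite check on one period. *)
Require Import Defs.
From mathcomp Require Import all_boot all_order all_algebra.
From mathcomp Require Import constructive_ereal.
From mathcomp Require Import zify.

Set Implicit Arguments.
Unset Strict Implicit.
Unset Printing Implicit Defensive.

Import Order.TTheory GRing.Theory Num.Theory.

Local Open Scope ring_scope.

(** For [i <= k], [p ^ i] divides [m] exactly when it divides [m %% p ^ k]. A nonzero residue has
    valuation below [k], so these exponents suffice to read off the valuation. *)
Lemma logn_modn_pow p k m : prime p -> (m %% p ^ k != 0)%N ->
  logn p (m %% p ^ k) = logn p m.
Proof.
move=> pp r0; have m0 : (0 < m)%N by case: m r0 => //; rewrite mod0n.
have dvdE i : (i <= k)%N -> (p ^ i %| m %% p ^ k)%N = (p ^ i %| m)%N.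
  by move=> le_ik; rewrite /dvdn modn_dvdm // dvdn_exp2l.
have lt_rk : (logn p (m %% p ^ k) < k)%N.
  rewrite ltnNge -pfactor_dvdn ?lt0n // dvdE // /dvdn; exact: r0.
apply/eqP; rewrite eqn_leq -pfactor_dvdn // -dvdE ?(ltnW lt_rk) //.
(* The exponent just above the valuation of the residue is still at most [k], by [lt_rk], so [dvdE]
   applies to it too. *)
rewrite pfactor_dvdn ?lt0n // leqnn /= leqNgt -pfactor_dvdn // -dvdE //.
by rewrite pfactor_dvdn ?lt0n // ltnn.
Qed.

(** Sliding a window of four residues takes linear time on bounded numbers, whereas evaluating [B43]
    branches into four calls. *)
Definition B43_step_mod (s : nat * nat * nat * nat) :=
  let: (x, y, z, t) := s in (y, z, t, (x + y + z + t) %% 128)%N.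

Definition B43_window_mod n := iter n B43_step_mod (0, 0, 0, 1)%N.

Lemma B43_window_modE n : B43_window_mod n =
  (B43 n %% 128, B43 n.+1 %% 128, B43 n.+2 %% 128, B43 n.+3 %% 128)%N.
Proof.
elim: n => [//|n IHn]; rewrite /B43_window_mod iterS -/(B43_window_mod n) IHn.
have -> : B43 n.+4 = (B43 n.+3 + B43 n.+2 + B43 n.+1 + B43 n)%N by [].
rewrite /B43_step_mod; congr (_, _, _, _).
by move: (B43 n) (B43 n.+1) (B43 n.+2) (B43 n.+3) => x y z t; lia.
Qed.

Definition B43_mod n := (B43_window_mod n).1.1.1.

Lemma B43_modE n : (B43 n %% 128)%N = B43_mod n.
Proof. by rewrite /B43_mod B43_window_modE. Qed.

Lemma B43_mod_period n : B43_mod n = B43_mod (n %% 320).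
Proof.
rewrite /B43_mod /B43_window_mod {1}(divn_eq n 320) addnC iterD.
(* It suffices that 320 steps bring the window back to its initial state, which is computed. *)
congr (iter _ _ _).1.1.1; elim: (n %/ 320)%N => [//|q IHq].
by rewrite mulSn iterD IHq; vm_compute.
Qed.

Lemma v2_nat (m : nat) : m != 0%N -> v2 m%:Z = (logn 2 m)%:Z%:E%E.
Proof. by move=> m0; rewrite /v2 ifN. Qed.

Lemma v2_B43 n : B43_mod (n %% 320) != 0%N ->
  v2 (B43 n)%:Z = (logn 2 (B43_mod (n %% 320)))%:Z%:E%E.
Proof.
rewrite -B43_mod_period -B43_modE => r0; rewrite (logn_modn_pow (k := 7)) //.
by rewrite v2_nat //; apply: contra r0 => /eqP->.
Qed.

(** A finite bound excludes [m = 0], and [2 ^ k.+1] cannot divide [m]; hence the residue is nonzero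
    and keeps the valuation. *)
Lemma v2_nat_le (m k : nat) : (v2 m%:Z <= k%:Z%:E)%E ->
  exists2 r, r = (m %% 2 ^ k.+1)%N &
    [/\ r != 0%N, v2 m%:Z = (logn 2 r)%:Z%:E%E & (logn 2 r <= k)%N].
Proof.
case: (eqVneq m 0%N) => [->|m0]; first by rewrite /v2 eqxx.
rewrite v2_nat // lee_fin lez_nat => le_mk; exists (m %% 2 ^ k.+1)%N => //.
have r0 : (m %% 2 ^ k.+1 != 0)%N.
  apply/negP; rewrite -[_ == _]/(2 ^ k.+1 %| m)%N pfactor_dvdn ?lt0n //.
  by rewrite ltnNge le_mk.
by rewrite logn_modn_pow.
Qed.

(** Here [r] stands for [a %% 64]. The tests [!= 0] guard against the default [logn 2 0 = 0];
    oddness needs no such guard. A nonzero product modulo 64 encodes valuation at most 5, and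
    [r %% 4 == 1] encodes [v2 (a - 1) >= 2]. *)
Definition B43_period_check r :=
  [&& (r %% 64 != 0)%N && (logn 2 r <= 2)%N ==>
        (B43_mod (5 * r) != 0%N) &&
        (logn 2 (B43_mod (5 * r)) == 1 + 2 * logn 2 r)%N,
      ((r * r.+1) %% 64 != 0)%N ==>
        (B43_mod (5 * r + 1) != 0%N) &&
        (logn 2 (B43_mod (5 * r + 1)) == 1 + logn 2 ((r * r.+1) %% 64))%N,
      (r %% 4 == 1)%N ==>
        (B43_mod (5 * r + 2) != 0%N) && (logn 2 (B43_mod (5 * r + 2)) == 3)%N,
      odd (B43_mod (5 * r + 3)) & odd (B43_mod (5 * r + 4))].

Lemma B43_period_checkP r : (r < 64)%N -> B43_period_check r.
Proof.
have /allP check : all B43_period_check (iota 0 64) by vm_compute.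
by move=> lt_r; apply: check; rewrite mem_iota.
Qed.

Lemma v2_B43_odd n : odd (B43_mod (n %% 320)) -> v2 (B43 n)%:Z = 0%:E%E.
Proof.
move=> o; rewrite v2_B43; last by case: (B43_mod _) o.
by rewrite lognE dvdn2 o andbF.
Qed.

Lemma modn320 (a j : nat) : (j < 5)%N ->
  ((5 * a + j) %% 320 = 5 * (a %% 64) + j)%N.
Proof. by move=> j5; lia. Qed.

Theorem theorem16 (n : nat) :
  [/\ forall a : nat, n = (5 * a)%N -> (v2 a%:Z <= 2%:E)%E ->
        v2 (B43 n)%:Z = (1%:E + 2%:E * v2 a%:Z)%E,
      forall a : nat, n = (5 * a + 1)%N -> (v2 (a%:Z * (a%:Z + 1)) <= 5%:E)%E ->
        v2 (B43 n)%:Z = (1%:E + v2 (a%:Z * (a%:Z + 1)))%E,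
      forall a : nat, n = (5 * a + 2)%N -> (2%:E <= v2 (a%:Z - 1))%E ->
        v2 (B43 n)%:Z = 3%:E,
      n = 3 %[mod 5] -> v2 (B43 n)%:Z = 0%:E
    & n = 4 %[mod 5] -> v2 (B43 n)%:Z = 0%:E].
Proof.
have check a : B43_period_check (a %% 64) by rewrite B43_period_checkP ?ltn_mod.
split.
- move=> a -> /v2_nat_le [_ -> [r0 -> le2]].
  have r64 : (a %% 64 != 0)%N by move: r0; rewrite (_ : 2 ^ 3 = 8)%N //; lia.
  (* The bound 2 yields a residue modulo 8, while the table is indexed modulo 64; both residues have
     the valuation of [a]. *)
  have e : logn 2 (a %% 2 ^ 3) = logn 2 (a %% 64).
    by rewrite logn_modn_pow // (logn_modn_pow (k := 6)).
  move: le2; rewrite e => le2.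
  have /and5P[/implyP] := check a; rewrite modn_mod r64 le2 => /(_ isT).
  move=> /andP[b0 /eqP bE] _ _ _ _.
  have := @modn320 a 0 isT; rewrite !addn0 => m320.
  by rewrite v2_B43 m320 // bE PoszD PoszM EFinD EFinM.
- move=> a ->; have -> : a%:Z * (a%:Z + 1) = (a * a.+1)%N%:Z by lia.
  move=> /v2_nat_le [_ -> [r0 -> _]].
  (* The successor of [a %% 64] may equal 64, so the factors are compared only modulo 64. *)
  have e : (a * a.+1 %% 2 ^ 6 = (a %% 64 * (a %% 64).+1) %% 64)%N.
    by rewrite -[(a %% 64).+1]addn1 modnMml -[RHS]modnMmr modnDml modnMmr addn1.
  have /and5P[_ /implyP] := check a; rewrite -e => /(_ r0).
  by move=> /andP[b0 /eqP bE] _ _ _; rewrite v2_B43 modn320 // bE PoszD EFinD.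
- move=> a -> ha.
  have a4 : (a %% 64 %% 4 == 1)%N.
    (* For [a = 0] the hypothesis fails, since -1 has valuation 0. For [a = 1] the valuation is
       [+oo], and 1 is indeed 1 modulo 4. *)
    case: a ha => [|a]; first by rewrite /v2.
    have -> : a.+1%:Z - 1 = a%:Z by lia.
    case: (posnP a) => [->//|a0]; rewrite v2_nat -?lt0n // lee_fin lez_nat.
    by rewrite -pfactor_dvdn // (_ : 2 ^ 2 = 4)%N //; lia.
  have /and5P[_ _ /implyP/(_ a4)/andP[b0 /eqP bE] _ _] := check a.
  by rewrite v2_B43 modn320 // bE.
- move=> n3; have -> : n = (5 * (n %/ 5) + 3)%N by lia.
  by apply: v2_B43_odd; rewrite modn320 //; have /and5P[] := check (n %/ 5)%N.
- move=> n4; have -> : n = (5 * (n %/ 5) + 4)%N by lia.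
  by apply: v2_B43_odd; rewrite modn320 //; have /and5P[] := check (n %/ 5)%N.
Qed.
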